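(* Let $\rho$ be an admissible correlation matrix, i.e. a real $q\times q$ matrix with $\rho^*\rho\le I_q$. Assume that the duplicated diffusion $(X,X^{(\rho)})$ has a unique invariant distribution $\mu^{(\rho)}$ (so that if $\rho=I_q$, $\mu^{(I_q)}=\nu_\Delta$). Let $$\hat\sigma_\rho^2=5\int_{\mathbb{R}^d}|\sigma^*\nabla g|^2d\nu-4\int_{\mathbb{R}^d\times\mathbb{R}^d}\big((\sigma^*\nabla g)(x)\,\big|\,\rho(\sigma^*\nabla g)(y)\big)\mu^{(\rho)}(dx,dy).$$ Then: (a) $\displaystyle\hat\sigma_\rho^2\ge\int_{\mathbb{R}^d}|\sigma^*\nabla g|^2d\nu$. (b) If $\rho=0$, then $\displaystyle\hat\sigma_\rho^2=5\int_{\mathbb{R}^d}|\sigma^*\nabla g|^2d\nu$. (c) If $\rho=I_q$, then $\displaystyle\hat\sigma_\rho^2=\int_{\mathbb{R}^d}|\sigma^*\nabla g|^2d\nu$.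
   Context: $b:\mathbb{R}^d\to\mathbb{R}^d$ and $\sigma:\mathbb{R}^d\to\mathcal{M}(d,q,\mathbb{R})$ are locally Lipschitz with linear growth; $X$ solves $dX_t=b(X_t)dt+\sigma(X_t)dW_t$ ($W$ a $q$-dimensional Brownian motion) and has a unique invariant distribution $\nu$. With $\widetilde W$ a $q$-dimensional Brownian motion independent of $W$ and $W^{(\rho)}=\rho^*W+\sqrt{I_q-\rho^*\rho}\,\widetilde W$, $X^{(\rho)}$ solves $dX^{(\rho)}_t=b(X^{(\rho)}_t)dt+\sigma(X^{(\rho)}_t)dW^{(\rho)}_t$. Both marginals of $\mu^{(\rho)}$ on $\mathbb{R}^d$ equal $\nu$. $\nu_\Delta=\nu\circ(x\mapsto(x,x))^{-1}$. ${}^*$ is transposition. The function $g:\mathbb{R}^d\to\mathbb{R}$ is a $\mathcal{C}^7$ solution of the Poisson equation $f-\nu(f)=\mathcal{A}g$, $\mathcal{A}g=(b|\nabla g)+\frac12\mathrm{Tr}(\sigma\sigma^*D^2g)$, such that $|f|$, $|g|$ and all partial derivatives of $g$ up to order 7 are dominated by $CV^r$ for some $C>0,r\ge0$, where $V$ is a function given by the following standing assumption $\mathbf{(S_a)}$, $a\in(0,1]$: $V:\mathbb{R}^d\to\mathbb{R}$ is positive, $\mathcal{C}^2$, $\lim_{|x|\to\infty}V(x)=+\infty$, $|\nabla V|^2\le CV$, $\sup_x\|D^2V(x)\|<+\infty$, and for some positive constants $C_b,\beta,\alpha$: $|b|^2\le C_bV^a$, $\mathrm{Tr}(\sigma\sigma^*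 )(x)=o(V^a(x))$ as $|x|\to\infty$, and $(\nabla V|b)\le\beta-\alpha V^a$. (In particular $|\sigma^*\nabla g|\in L^2(\nu)$.) *)

(* Defs.v *)
From HB Require Import structures.
From mathcomp Require Import all_boot all_order all_algebra.
From mathcomp Require Import all_classical all_reals all_analysis.

Set Implicit Arguments.
Unset Strict Implicit.
Unset Printing Implicit Defensive.

Import Order.TTheory GRing.Theory Num.Theory.
Import numFieldNormedType.Exports.

Local Open Scope classical_set_scope.
Local Open Scope ring_scope.

(* R^n as column vectors. The topology and the norm [`|_|] (maximum norm) of
   ['cV[R]_n] are those of the library; [`|_|] is used only in conditions that
   do not depend on the choice of a norm on a finite-dimensional space. The
   Euclidean structure is [dotp] and [sqnorm]. *)

Definition borelV (R : realType) (n : nat) :=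
  g_sigma_algebraType (@open 'cV[R]_n).

Section euclidean.
Context {R : realType} {n : nat}.

Definition dotp (u v : 'cV[R]_n) : R := (u^T *m v) 0 0.

Definition sqnorm (u : 'cV[R]_n) : R := dotp u u.

Definition psd_mx (A : 'M[R]_n) : Prop :=
  A^T = A /\ forall u : 'cV[R]_n, 0 <= dotp u (A *m u).

(* [S] is the (unique) symmetric nonnegative square root of [A]. *)
Definition is_sqrt_mx (A S : 'M[R]_n) : Prop := psd_mx S /\ S *m S = A.

Definition admissible_correlation (rho : 'M[R]_n) : Prop :=
  psd_mx (1%:M - rho^T *m rho).

End euclidean.

Section differential.
Context {R : realType} {n : nat}.
Implicit Types f : 'cV[R]_n -> R.

Definition partial (i : 'I_n) f : 'cV[R]_n -> R :=
  fun x => 'D_(delta_mx i 0) f x.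

Definition partials (s : seq 'I_n) f : 'cV[R]_n -> R := foldr partial f s.

Definition class_C (k : nat) f : Prop :=
  forall s : seq 'I_n, (size s <= k)%N ->
    continuous (partials s f) /\
    ((size s < k)%N ->
     forall i x, derivable (partials s f) x (delta_mx i 0)).

Definition grad f (x : 'cV[R]_n) : 'cV[R]_n := \col_i partial i f x.

Definition hessian f (x : 'cV[R]_n) : 'M[R]_n :=
  \matrix_(i, j) partials [:: i; j] f x.

End differential.

Section coefficients.
Context {R : realType} {d q : nat}.
Variables (b : 'cV[R]_d -> 'cV[R]_d) (sigma : 'cV[R]_d -> 'M[R]_(d, q)).

Definition loc_lipschitz (m p : nat) (h : 'cV[R]_d -> 'M[R]_(m, p)) : Prop :=
  forall x : 'cV[R]_d, exists2 U, nbhs x U & [lipschitz h y | y in U].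

Definition linear_growth (m p : nat) (h : 'cV[R]_d -> 'M[R]_(m, p)) : Prop :=
  exists C : R, forall x, `|h x| <= C * (1 + `|x|).

Definition generator (g : 'cV[R]_d -> R) (x : 'cV[R]_d) : R :=
  dotp (b x) (grad g x)
  + 2^-1 * \tr (sigma x *m (sigma x)^T *m hessian g x).

Definition lyapunov_assumption (a : R) (V : 'cV[R]_d -> R) : Prop :=
  [/\ (forall x, 0 < V x) /\ class_C 2 V,
      forall A : R, \forall M \near +oo, forall x : 'cV[R]_d, M <= `|x| -> A <= V x,
      (exists2 C : R, 0 < C & forall x, sqnorm (grad V x) <= C * V x) /\
      (exists M : R, forall x, `|hessian V x| <= M),
      (exists2 Cb : R, 0 < Cb & forall x, sqnorm (b x) <= Cb * V x `^ a) /\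
      (exists beta alpha : R, [/\ 0 < beta, 0 < alpha &
         forall x, dotp (grad V x) (b x) <= beta - alpha * V x `^ a]) &
      forall e : R, 0 < e -> \forall M \near +oo, forall x : 'cV[R]_d, M <= `|x| ->
        \tr (sigma x *m (sigma x)^T) <= e * V x `^ a].

End coefficients.

(* Stochastic differential equations. Time is the half-line [0 <= t] of [R];
   the values of processes and filtrations at negative times are irrelevant. *)
Section stochastic.
Context {R : realType} {dO : measure_display} {Omega : measurableType dO}.
Variables (P : probability Omega R) (F : R -> set (set Omega)).

Definition is_filtration : Prop :=
  [/\ forall t : R, 0 <= t -> sigma_algebra setT (F t),
      forall t : R, 0 <= t -> F t `<=` measurable &
      forall s t : R, 0 <= s -> s <= t -> F s `<=` F t].

Definition adapted (n : nat) (X : R -> Omega -> 'cV[R]_n) : Prop :=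
  forall t : R, 0 <= t -> forall A : set (borelV R n), measurable A ->
    F t (X t @^-1` A).

Definition continuous_paths (n : nat) (X : R -> Omega -> 'cV[R]_n) : Prop :=
  forall w, {within [set t : R | 0 <= t], continuous (X ^~ w)}.

Definition increment (n : nat) (W : R -> Omega -> 'cV[R]_n) (s t : R)
    (w : Omega) : 'cV[R]_n := W t w - W s w.

(* [W] is an [n]-dimensional [F]-Brownian motion: its increments [W t - W s]
   are independent of [F s] and follow the Gaussian law N(0, (t - s) I_n), i.e.
   every nonzero linear form [dotp u] of them is N(0, (t - s) |u|^2).
   The second parameter of [normal_prob] is a standard deviation, and the value
   0 of that parameter does not give a Dirac mass, hence [u != 0], [s < t]. *)
Definition brownian_motion (n : nat) (W : R -> Omega -> 'cV[R]_n) : Prop :=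
  [/\ adapted W, continuous_paths W, forall w, W 0 w = 0,
      forall s t : R, 0 <= s -> s < t ->
        forall (A : set Omega) (B : set (borelV R n)), F s A -> measurable B ->
          P (A `&` increment W s t @^-1` B)
          = (P A * P (increment W s t @^-1` B))%E &
      forall s t : R, 0 <= s -> s < t -> forall u : 'cV[R]_n, u != 0 ->
        forall B : set R, measurable B ->
          P [set w | B (dotp u (increment W s t w))]
          = normal_prob 0 (Num.sqrt ((t - s) * sqnorm u)) B].

Definition cvg_in_probability (n : nat)
    (Y : nat -> Omega -> 'cV[R]_n) (Z : Omega -> 'cV[R]_n) : Prop :=
  forall e : R, 0 < e ->
    P [set w | e <= `|Y k w - Z w|] @[k --> \oo] --> 0%E.

Definition riemann_sum (m n : nat) (H : R -> Omega -> 'M[R]_(m, n))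
    (W : R -> Omega -> 'cV[R]_n) (t : R) (N : nat) (w : Omega) : 'cV[R]_m :=
  \sum_(k < N) H (t * k%:R / N%:R) w
    *m increment W (t * k%:R / N%:R) (t * k.+1%:R / N%:R) w.

(* [I] is the Ito integral of [H] with respect to [W] over [[0, t]]. For an
   adapted integrand with continuous paths (the only case used here) it is the
   limit in probability of the left-point Riemann sums. *)
Definition is_ito_integral (m n : nat) (H : R -> Omega -> 'M[R]_(m, n))
    (W : R -> Omega -> 'cV[R]_n) (t : R) (I : Omega -> 'cV[R]_m) : Prop :=
  cvg_in_probability (riemann_sum H W t) I.

Definition time_integral (n : nat) (h : R -> 'cV[R]_n) (t : R) : 'cV[R]_n :=
  \col_i \int[lebesgue_measure]_(s in `[0, t]) h s i 0.

(* X_t = x + int_0^t b(X_s) ds + int_0^t sigma(X_s) dW_s *)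
Definition solves_sde (d q : nat)
    (b : 'cV[R]_d -> 'cV[R]_d) (sigma : 'cV[R]_d -> 'M[R]_(d, q))
    (W : R -> Omega -> 'cV[R]_q) (x : 'cV[R]_d)
    (X : R -> Omega -> 'cV[R]_d) : Prop :=
  [/\ adapted X, continuous_paths X, forall w, X 0 w = x &
      forall t : R, 0 <= t ->
        is_ito_integral (fun s w => sigma (X s w)) W t
          (fun w => X t w - x - time_integral (fun s => b (X s w)) t)].

End stochastic.

Section diffusions.
Context {R : realType} {d q : nat}.
Variables (b : 'cV[R]_d -> 'cV[R]_d) (sigma : 'cV[R]_d -> 'M[R]_(d, q)).

(* [X] is the diffusion dX = b(X) dt + sigma(X) dW started at [x]. *)
Definition diffusion (dO : measure_display) (Omega : measurableType dO)
    (P : probability Omega R) (x : borelV R d)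
    (X : R -> Omega -> borelV R d) : Prop :=
  exists (F : R -> set (set Omega)) (W : R -> Omega -> 'cV[R]_q),
    [/\ is_filtration F, brownian_motion P F W & solves_sde P F b sigma W x X].

(* [Z = (X, X^(rho))] is the duplicated diffusion started at [z]; its first
   component is driven by [W] and its second one by
   [rho^T W + sqrt (I_q - rho^T rho) W']. That [W] and [W'] are independent
   [q]-dimensional [F]-Brownian motions is expressed by [(W, W')] being a
   [2q]-dimensional [F]-Brownian motion. *)
Definition duplicated_diffusion (rho : 'M[R]_q)
    (dO : measure_display) (Omega : measurableType dO)
    (P : probability Omega R) (z : borelV R d * borelV R d)
    (Z : R -> Omega -> borelV R d * borelV R d) : Prop :=
  exists (F : R -> set (set Omega)) (W W' : R -> Omega -> 'cV[R]_q)
         (S : 'M[R]_q),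
    [/\ is_filtration F,
        brownian_motion P F (fun t w => col_mx (W t w) (W' t w)),
        is_sqrt_mx (1%:M - rho^T *m rho) S,
        solves_sde P F b sigma W z.1 (fun t w => (Z t w).1) &
        solves_sde P F b sigma (fun t w => rho^T *m W t w + S *m W' t w)
          z.2 (fun t w => (Z t w).2)].

End diffusions.

Section invariance.
Context {R : realType} {dE : measure_display} {E : measurableType dE}.

(* [proc P x X] stands for: [X] is a version, on the probability space of [P],
   of the process started at [x]. *)
Variable proc : forall (dO : measure_display) (Omega : measurableType dO),
  probability Omega R -> E -> (R -> Omega -> E) -> Prop.

(* [p t x] is the law at time [t] of the process started at [x]. *)
Definition transition_semigroup (p : R -> R.-pker E ~> E) : Prop :=
  forall x : E,
    (exists (dO : measure_display) (Omega : measurableType dO)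
            (P : probability Omega R) (X : R -> Omega -> E), proc P x X) /\
    (forall (dO : measure_display) (Omega : measurableType dO)
            (P : probability Omega R) (X : R -> Omega -> E), proc P x X ->
       forall (t : R) (A : set E), 0 <= t -> measurable A ->
         P (X t @^-1` A) = p t x A).

(* nu p_t = nu for all t >= 0 *)
Definition invariant_distribution (nu : probability E R) : Prop :=
  exists2 p : R -> R.-pker E ~> E, transition_semigroup p &
    forall (t : R) (A : set E), 0 <= t -> measurable A ->
      (\int[nu]_x p t x A)%E = nu A.

Definition unique_invariant_distribution (nu : probability E R) : Prop :=
  invariant_distribution nu /\
  forall nu' : probability E R, invariant_distribution nu' ->
    forall A : set E, measurable A -> nu' A = nu A.

End invariance.

Section variance.
Context {R : realType} {d q : nat}.
Variables (sigma : 'cV[R]_d -> 'M[R]_(d, q)) (g : 'cV[R]_d -> R).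

Definition sigma_grad (x : 'cV[R]_d) : 'cV[R]_q := (sigma x)^T *m grad g x.

Definition asymptotic_variance (rho : 'M[R]_q) (nu : probability (borelV R d) R)
    (mu : probability (borelV R d * borelV R d)%type R) : R :=
  5 * (\int[nu]_x sqnorm (sigma_grad x))
  - 4 * (\int[mu]_z dotp (sigma_grad z.1) (rho *m sigma_grad z.2)).

End variance.

(* Main.v *)
Require Import Defs.
From HB Require Import structures.
From mathcomp Require Import all_boot all_order all_algebra.
From mathcomp Require Import all_classical all_reals all_analysis.
From mathcomp Require Import measurable_realfun lra.

Import Order.TTheory GRing.Theory Num.Theory.
Import numFieldNormedType.Exports.

Local Open Scope classical_set_scope.
Local Open Scope ring_scope.

(** Write [s] for [sigma_grad sigma g], [I] for the integral of [|s|^2] under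
    [nu] and [J] for the integral of [(s x | rho (s y))] under [mu], so that the
    asymptotic variance is [5 I - 4 J].

    If [rho = 0] then [J = 0]. In general both marginals of [mu] are [nu], and
    since [rho^T rho <= 1] gives [|rho v| <= |v|], the inequality
    [(u | rho v) <= (|u|^2 + |v|^2) / 2] integrates to [J <= I]
    ([correlation_le]). If [rho = 1] then [mu] is the image of [nu] under
    [x |-> (x, x)], and [J = I].

    The facts about [mu] are obtained without any stochastic calculus, from the
    uniqueness of the invariant distributions. If a map [h] turns, for every
    starting point, some copy of a Markov process into a copy of another one,
    it carries invariant distributions to invariant distributions
    ([invariant_pushforward]). This is used three times.
    - The two projections map the duplicated diffusion to the diffusion, because
      both [W] and [rho^T W + S W'] are images of the Brownian motion [(W, W')]
      by matrices [L] such that [L L^T = 1] ([brownian_motion_isometry]). So the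
      marginals of [mu] are invariant for the diffusion, hence equal to [nu].
    - For [rho = 1], the diagonal map takes the diffusion to the duplicated
      diffusion: here [S = 0], so the two components are driven by the same
      [W], and [(X, X)] is a duplicated diffusion whenever [X] is the first
      component of one ([duplicated_diffusion_diagonal]). So the image of [nu]
      on the diagonal is invariant, hence equal to [mu]. *)

(** * Euclidean inequalities *)

Section euclidean.
Context {R : realType}.

Lemma dotpE n (u v : 'cV[R]_n) : dotp u v = \sum_i u i 0 * v i 0.
Proof. by rewrite /dotp mxE; apply: eq_bigr => i _; rewrite mxE. Qed.

Lemma dotp_mulmxr m n (A : 'M[R]_(m, n)) (u : 'cV[R]_m) (v : 'cV[R]_n) :
  dotp u (A *m v) = dotp (A^T *m u) v.
Proof. by rewrite /dotp trmx_mul trmxK mulmxA. Qed.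

Lemma sqnorm_mulmx m n (A : 'M[R]_(m, n)) (u : 'cV[R]_n) :
  sqnorm (A *m u) = dotp u (A^T *m A *m u).
Proof. by rewrite /sqnorm -mulmxA [RHS]dotp_mulmxr trmxK. Qed.

Lemma sqnorm_isometry m n (A : 'M[R]_(m, n)) (u : 'cV[R]_n) :
  A^T *m A = 1%:M -> sqnorm (A *m u) = sqnorm u.
Proof. by move=> A1; rewrite sqnorm_mulmx A1 mul1mx. Qed.

Lemma sqnorm_contraction n (rho : 'M[R]_n) (u : 'cV[R]_n) :
  admissible_correlation rho -> sqnorm (rho *m u) <= sqnorm u.
Proof.
move=> [_ /(_ u)]; rewrite sqnorm_mulmx mulmxBl mul1mx /sqnorm {1}/dotp.
by rewrite mulmxBr mxE [X in _ + X]mxE subr_ge0.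
Qed.

Lemma norm_dotp_le n (u v : 'cV[R]_n) :
  `|dotp u v| <= 2^-1 * (sqnorm u + sqnorm v).
Proof.
rewrite /sqnorm !dotpE -big_split mulr_sumr /=.
apply: le_trans (ler_norm_sum _ _ _) _; apply: ler_sum => i _.
have := sqr_ge0 (u i 0 - v i 0); have := sqr_ge0 (u i 0 + v i 0).
by rewrite ler_norml !expr2 => ? ?; apply/andP; split; lra.
Qed.

(** Each column of [S] has square norm [(e_j | S^T S e_j) = 0]. *)
Lemma sym_mulmx_eq0 n (S : 'M[R]_n) : S^T = S -> S *m S = 0 -> S = 0.
Proof.
move=> ST SS; apply/matrixP => i j; rewrite mxE.
have : sqnorm (S *m delta_mx j 0) = 0.
  by rewrite sqnorm_mulmx ST SS mul0mx /dotp mulmx0 mxE.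
rewrite /sqnorm dotpE => /eqP; rewrite psumr_eq0 => [|k _]; last first.
  by rewrite -expr2 sqr_ge0.
move=> /allP /(_ i); rewrite mem_index_enum => /(_ isT).
by rewrite -colE mxE mulf_eq0 orbb => /eqP.
Qed.

End euclidean.

(** * Continuous maps and Borel sets of column vectors *)

Section borel.
Context {R : realType}.

Lemma mx_continuous (T : topologicalType) m n (f : T -> 'M[R]_(m, n)) :
  (forall i j, continuous (fun x => f x i j)) -> continuous f.
Proof.
move=> cf x A [P fP PA].
have : \forall y \near x, forall i j, P i j (f y i j).
  by apply: filter_forall => i; apply: filter_forall => j; exact/cf/fP.
by apply: filterS => y Py; exact: PA.
Qed.

Lemma mulmx_continuous m n p (L : 'M[R]_(m, n)) :
  continuous (fun u : 'M[R]_(n, p) => L *m u).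
Proof.
apply: mx_continuous => i j.
rewrite (_ : (fun u : 'M[R]_(n, p) => _) = fun u => \sum_k L i k * u k j).
  apply: continuous_big => [|k _]; first exact: add_continuous.
  move=> u; apply: continuousM; [exact: cst_continuous|exact: coord_continuous].
by apply/funext => u; rewrite mxE.
Qed.

Lemma loc_lipschitz_continuous d m p (h : 'cV[R]_d -> 'M[R]_(m, p)) :
  loc_lipschitz h -> continuous h.
Proof.
move=> h_lip x; have [U Ux /pinfty_ex_gt0[k k0 hk]] := h_lip x.
apply/(@cvgrPdist_lt _ _ _ _ (nbhs_filter x)) => e e0; near=> y.
have Uy : U y by near: y.
have /= hxy := hk (x, y) (conj (nbhs_singleton Ux) Uy).
apply: le_lt_trans hxy _; rewrite -ltr_pdivlMl// mulrC.
near: y; have := nbhsx_ballx x _ (divr_gt0 e0 k0).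
by rewrite -ball_normE.
Unshelve. all: by end_near. Qed.

Lemma continuous_measurable_borelV m n (h : 'cV[R]_m -> 'cV[R]_n) :
  continuous h -> measurable_fun setT (h : borelV R m -> borelV R n).
Proof.
move=> /continuousP ch; 
apply: (@measurability _ _ (borelV R m) (borelV R n) setT h (@open 'cV[R]_n)).
  by [].
by move=> _ [A oA <-]; rewrite setTI; apply: sub_sigma_algebra; exact: ch.
Qed.

Lemma continuous_measurable_real n (h : 'cV[R]_n -> R) :
  continuous h -> measurable_fun setT (h : borelV R n -> R).
Proof.
move=> /continuousP ch; apply: (measurability _ (RGenOpens.measurableE R)).
move=> _ [_ [x [y ->]] <-]; rewrite setTI; apply: sub_sigma_algebra.
exact/ch/interval_open.
Qed.

End borel.

(** * Brownian motions driving the duplicated diffusion *)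

Section brownian.
Context {R : realType} {dO : measure_display} {Omega : measurableType dO}.
Variables (P : probability Omega R) (F : R -> set (set Omega)).

(** A linear form [u] of [L B] is the linear form [L^T u] of [B], and
    [|L^T u| = |u|] since [L^T] is an isometry: the increments of [L B] keep the
    standard Gaussian law. The other properties pass to [L B] because [L] is
    continuous and hence Borel. The matrix [L] may be rectangular: projections
    and correlated combinations of two Brownian motions are both covered. *)
Lemma brownian_motion_isometry m n (L : 'M[R]_(m, n)) (B : R -> Omega -> 'cV[R]_n) :
  L *m L^T = 1%:M -> brownian_motion P F B ->
  brownian_motion P F (fun t w => L *m B t w).
Proof.
move=> LL [B_adapted B_cont B0 B_indep B_normal].
have L_meas (A : set (borelV R m)) : measurable A ->
    measurable ((mulmx L : borelV R n -> borelV R m) @^-1` A).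
  move=> mA; rewrite -[X in measurable X]setTI.
  exact: (continuous_measurable_borelV _ _ _ (@mulmx_continuous _ _ _ _ L)).
have incL s t w :
    increment (fun t w => L *m B t w) s t w = L *m increment B s t w.
  by rewrite /increment mulmxBr.
split.
- by move=> t t0 A mA; exact: (B_adapted t t0 _ (L_meas A mA)).
- move=> w; apply: (within_continuous_comp _ (B ^~ w) (mulmx L)) => // u _.
  exact: mulmx_continuous.
- by move=> w; rewrite B0 mulmx0.
- move=> s t s0 st A D FA mD.
  have -> : increment (fun t w => L *m B t w) s t @^-1` D
            = increment B s t @^-1` (mulmx L @^-1` D).
    by apply/seteqP; split => w /=; rewrite incL.
  exact: (B_indep s t s0 st _ _ FA (L_meas D mD)).
- move=> s t s0 st u u0 D mD.
  rewrite -(sqnorm_isometry _ _ L^T u) ?trmxK//.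
  rewrite -(B_normal s t s0 st _ _ D mD); last first.
    (* [L^T] has the left inverse [L], so that [L^T u] is nonzero. *)
    apply: contraNneq u0 => Lu0.
    by rewrite -[u]mul1mx -LL -mulmxA Lu0 mulmx0.
  by congr (P _); apply/seteqP; split => w /=; rewrite incL dotp_mulmxr.
Qed.

End brownian.

Section diffusions.
Context {R : realType} {d q : nat}.
Variables (b : 'cV[R]_d -> 'cV[R]_d) (sigma : 'cV[R]_d -> 'M[R]_(d, q)).

(** The second driving process is [L (W, W')] with [L = (rho^T, S)], and
    [L L^T = rho^T rho + S S = 1] by the choice of [S]; the first one is
    [L (W, W')] with [L = (1, 0)]. *)
Lemma duplicated_diffusion_marginals (rho : 'M[R]_q)
    (dO : measure_display) (Omega : measurableType dO) (P : probability Omega R)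
    (z : borelV R d * borelV R d) (Z : R -> Omega -> borelV R d * borelV R d) :
  duplicated_diffusion b sigma rho P z Z ->
  diffusion b sigma P z.1 (fun t w => (Z t w).1) /\
  diffusion b sigma P z.2 (fun t w => (Z t w).2).
Proof.
move=> [F [W [W' [S [F_filtr B_brown [[ST _] SS] Z1 Z2]]]]]; split.
- exists F, W; split => //.
  have := brownian_motion_isometry P F _ _ (row_mx 1%:M 0) _ _ B_brown.
  rewrite tr_row_mx mul_row_col trmx1 mul1mx mul0mx addr0 => /(_ erefl).
  by under eq_fun do under eq_fun do rewrite mul_row_col mul1mx mul0mx addr0.
- exists F, (fun t w => rho^T *m W t w + S *m W' t w); split => //.
  have := brownian_motion_isometry P F _ _ (row_mx rho^T S) _ _ B_brown.
  rewrite tr_row_mx mul_row_col trmxK ST SS addrC subrK => /(_ erefl).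
  by under eq_fun do under eq_fun do rewrite mul_row_col.
Qed.

(** With [rho = 1] the square root [S] of [1 - rho^T rho] vanishes, so the
    equation of the second component is that of the first one. The copy of the
    diffusion is taken inside an existing duplicated diffusion rather than from
    an arbitrary diffusion because the same probability space must also carry
    the second Brownian motion [W']. *)
Lemma duplicated_diffusion_diagonal
    (dO : measure_display) (Omega : measurableType dO) (P : probability Omega R)
    (x : borelV R d) (Z : R -> Omega -> borelV R d * borelV R d) :
  duplicated_diffusion b sigma 1%:M P (x, x) Z ->
  duplicated_diffusion b sigma 1%:M P (x, x)
    (fun t w => ((Z t w).1, (Z t w).1)).
Proof.
move=> [F [W [W' [S [F_filtr B_brown S_sqrt Z1 _]]]]].
exists F, W, W', S; split => //=.
have S0 : S = 0.
  case: S_sqrt => -[ST _] SS; apply: sym_mulmx_eq0 => //.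
  by rewrite SS trmx1 mulmx1 subrr.
under eq_fun do under eq_fun do rewrite S0 trmx1 mul1mx mul0mx addr0.
exact: Z1.
Qed.

End diffusions.

(** * Images of invariant distributions *)

Section invariance.
Context {R : realType}.

Definition process_family (dE : measure_display) (E : measurableType dE) :=
  forall (dO : measure_display) (Omega : measurableType dO),
    probability Omega R -> E -> (R -> Omega -> E) -> Prop.

Context {dE dE' : measure_display} {E : measurableType dE}
  {E' : measurableType dE'}.

Lemma pushforward_probability (nu : probability E R) (h : E -> E') :
  measurable_fun setT h ->
  exists nu' : probability E' R, forall A, nu' A = nu (h @^-1` A).
Proof.
move=> mh; pose X : {mfun E >-> E'} := mfun_Sub (mem_set mh).
by exists (distribution nu X).
Qed.

(** Since a transition semigroup gives the law of every version of the process,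
    one version [X] from [x] such that [h X] is a version from [h x] forces
    [p' t (h x) A = p t x (h @^-1` A)]; integrating this against [nu] gives the
    invariance of the image. Asking for a single version, and not for all of
    them, is what lets the lemma apply to the diagonal map. *)
Lemma invariant_pushforward (proc : process_family dE E)
    (proc' : process_family dE' E') (h : E -> E')
    (nu : probability E R) (nu' : probability E' R)
    (p' : R -> R.-pker E' ~> E') :
  measurable_fun setT h ->
  (forall A, measurable A -> nu' A = nu (h @^-1` A)) ->
  (forall x, exists (dO : measure_display) (Omega : measurableType dO)
     (P : probability Omega R) (X : R -> Omega -> E),
     proc dO Omega P x X /\ proc' dO Omega P (h x) (fun t w => h (X t w))) ->
  transition_semigroup proc' p' ->
  invariant_distribution proc nu -> invariant_distribution proc' nu'.
Proof.
move=> mh nu'E coupling p'_semi [p p_semi p_inv]; exists p' => // t A t0 mA.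
have mhA : measurable (h @^-1` A) by rewrite -[X in measurable X]setTI; exact: mh.
rewrite (eq_measure_integral (pushforward nu h)); last first.
  by move=> B mB _; exact: nu'E.
rewrite ge0_integral_pushforward//; last exact: measurable_kernel.
rewrite nu'E// -(p_inv t _ t0 mhA) preimage_setT.
apply: eq_integral => x _ /=.
have [dO [T [P [X [pX Xp']]]]] := coupling x.
rewrite -((p'_semi (h x)).2 _ _ _ _ Xp' t A t0 mA).
exact: ((p_semi x).2 _ _ _ _ pX t _ t0 mhA).
Qed.

Lemma integrable_transport (nu : probability E R) (nu' : probability E' R)
    (h : E -> E') (f : E' -> R) :
  measurable_fun setT h ->
  (forall A, measurable A -> nu' A = nu (h @^-1` A)) ->
  nu'.-integrable setT (EFin \o f) ->
  nu.-integrable setT (EFin \o (f \o h)) /\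
  \int[nu]_x f (h x) = \int[nu']_y f y.
Proof.
move=> mh nu'E fi; have [mf foo] := integrableP _ _ _ fi.
have fhi : nu.-integrable setT (EFin \o (f \o h)).
  apply/integrableP; split; first exact: measurableT_comp mf mh.
  apply: le_lt_trans foo.
  rewrite [leRHS](eq_measure_integral (pushforward nu h)); last first.
    by move=> B mB _; exact: nu'E.
  rewrite ge0_integral_pushforward//.
  exact: measurableT_comp.
split=> //; rewrite /Rintegral; congr fine.
rewrite [RHS](eq_measure_integral (pushforward nu h)); last first.
  by move=> B mB _; exact: nu'E.
by rewrite integral_pushforward.
Qed.

End invariance.

(** * Marginals and diagonal of the duplicated diffusion *)

Section invariant_laws.
Context {R : realType} {d q : nat}.
Variables (b : 'cV[R]_d -> 'cV[R]_d) (sigma : 'cV[R]_d -> 'M[R]_(d, q)).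
Variables (nu : probability (borelV R d) R)
  (mu : probability (borelV R d * borelV R d)%type R).
Hypothesis nu_inv : unique_invariant_distribution (@diffusion R d q b sigma) nu.

(** Both marginals are invariant for the diffusion, so uniqueness identifies
    them with [nu]. *)
Lemma marginals_invariant (rho : 'M[R]_q) :
  invariant_distribution (@duplicated_diffusion R d q b sigma rho) mu ->
  forall A : set (borelV R d), measurable A ->
    nu A = mu (fst @^-1` A) /\ nu A = mu (snd @^-1` A).
Proof.
move=> mu_inv.
have [[p p_semi _] nu_uniq] := nu_inv.
have [pmu pmu_semi _] := mu_inv.
suff marginal (h : borelV R d * borelV R d -> borelV R d) :
    measurable_fun setT h ->
    (forall dO (Omega : measurableType dO) (P : probability Omega R) z Z,
      duplicated_diffusion b sigma rho P z Z ->
      diffusion b sigma P (h z) (fun t w => h (Z t w))) ->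
    forall A, measurable A -> nu A = mu (h @^-1` A).
  move=> A mA; split; apply: marginal => //.
  - move=> dO Omega P z Z dZ.
    exact: (duplicated_diffusion_marginals b sigma _ _ _ _ _ _ dZ).1.
  - move=> dO Omega P z Z dZ.
    exact: (duplicated_diffusion_marginals b sigma _ _ _ _ _ _ dZ).2.
move=> mh dup A mA; have [nu' nu'E] := pushforward_probability mu h mh.
rewrite -nu'E -(nu_uniq nu')//.
apply: (invariant_pushforward _ _ h mu nu' p mh _ _ p_semi mu_inv) => // z.
have [[dO [T [P [Z dZ]]]] _] := pmu_semi z.
by exists dO, T, P, Z; split => //; exact: dup.
Qed.

Definition diag (x : borelV R d) : borelV R d * borelV R d := (x, x).

Lemma measurable_diag : measurable_fun setT diag.
Proof. exact: measurable_fun_pair. Qed.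

(** Here uniqueness is used for the duplicated diffusion: the image of [nu] on
    the diagonal is another invariant distribution for it. *)
Lemma full_correlation_diagonal :
  unique_invariant_distribution
    (@duplicated_diffusion R d q b sigma 1%:M) mu ->
  forall A, measurable A -> mu A = nu (diag @^-1` A).
Proof.
move=> [[pmu pmu_semi _] mu_uniq] A mA.
have [nud nudE] := pushforward_probability nu diag measurable_diag.
rewrite -nudE -(mu_uniq nud)//.
apply: (invariant_pushforward _ _ diag nu nud pmu measurable_diag _ _ pmu_semi
  nu_inv.1) => // x.
have [[dO [T [P [Z dZ]]]] _] := pmu_semi (x, x).
have ZZ := duplicated_diffusion_diagonal b sigma _ _ _ _ _ dZ.
exists dO, T, P, (fun t w => (Z t w).1); split => //.
exact: (duplicated_diffusion_marginals b sigma _ _ _ _ _ _ dZ).1.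
Qed.

End invariant_laws.

(** * The correlation term of the asymptotic variance *)

Lemma class_C_le (R : realType) n k l (f : 'cV[R]_n -> R) :
  (k <= l)%N -> class_C l f -> class_C k f.
Proof.
move=> kl f_Cl s sk; have [cf df] := f_Cl s (leq_trans sk kl).
by split=> // s_lt; apply: df; exact: leq_trans s_lt kl.
Qed.

Section variance.
Context {R : realType} {d q : nat}.
Variables (sigma : 'cV[R]_d -> 'M[R]_(d, q)) (g : 'cV[R]_d -> R).
Hypotheses (sigma_lip : loc_lipschitz sigma) (g_C1 : class_C 1 g).

Lemma measurable_sigma_grad k :
  measurable_fun setT (fun x : borelV R d => sigma_grad sigma g x k 0).
Proof.
rewrite (_ : (fun x => _) = fun x => \sum_i sigma x i k * partial i g x).
  apply: measurable_sum => i; apply: measurable_funM.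
    apply: continuous_measurable_real => x.
    apply: (@continuous_comp _ _ _ sigma (fun M : 'M[R]_(d, q) => M i k)).
      exact: loc_lipschitz_continuous.
    exact: coord_continuous.
  by apply: continuous_measurable_real; have [] := g_C1 [:: i] isT.
by apply/funext => x; rewrite mxE; apply: eq_bigr => i _; rewrite !mxE.
Qed.

Lemma measurable_correlation (rho : 'M[R]_q) :
  measurable_fun setT (fun z : borelV R d * borelV R d =>
    dotp (sigma_grad sigma g z.1) (rho *m sigma_grad sigma g z.2)).
Proof.
rewrite (_ : (fun z => _) = fun z => \sum_k sigma_grad sigma g z.1 k 0
    * \sum_l rho k l * sigma_grad sigma g z.2 l 0); last first.
  apply/funext => z; rewrite dotpE; apply: eq_bigr => k _.
  by congr (_ * _); rewrite mxE.
apply: measurable_sum => k; apply: measurable_funM.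
  exact: (measurableT_comp (measurable_sigma_grad k) measurable_fst).
apply: measurable_sum => l; apply: measurable_funM => //.
exact: (measurableT_comp (measurable_sigma_grad l) measurable_snd).
Qed.

Variables (nu : probability (borelV R d) R)
  (mu : probability (borelV R d * borelV R d)%type R) (rho : 'M[R]_q).
Hypothesis L2 : nu.-integrable setT (fun x => (sqnorm (sigma_grad sigma g x))%:E).
Hypothesis marginals : forall A : set (borelV R d), measurable A ->
  nu A = mu (fst @^-1` A) /\ nu A = mu (snd @^-1` A).
Hypothesis rho_adm : admissible_correlation rho.

(** The bound [|(s x | rho (s y))| <= (|s x|^2 + |s y|^2) / 2] gives both
    conclusions, because each term on the right has integral half that of
    [|s|^2] under [nu] by the marginal hypothesis. *)
Lemma correlation_le :
  mu.-integrable setT (fun z =>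
    (dotp (sigma_grad sigma g z.1) (rho *m sigma_grad sigma g z.2))%:E) /\
  \int[mu]_z dotp (sigma_grad sigma g z.1) (rho *m sigma_grad sigma g z.2)
    <= \int[nu]_x sqnorm (sigma_grad sigma g x).
Proof.
set N := fun x : borelV R d => sqnorm (sigma_grad sigma g x).
have [i1 e1] := integrable_transport mu nu fst N measurable_fst
  (fun A mA => (marginals A mA).1) L2.
have [i2 e2] := integrable_transport mu nu snd N measurable_snd
  (fun A mA => (marginals A mA).2) L2.
pose M z := 2^-1 * (N z.1 + N z.2).
have iD : mu.-integrable setT (EFin \o (fun z => N z.1 + N z.2)).
  exact: (integrableD measurableT i1 i2).
have iM : mu.-integrable setT (EFin \o M).
  exact: (integrableZl measurableT 2^-1 iD).
have le_M z :
    `|dotp (sigma_grad sigma g z.1) (rho *m sigma_grad sigma g z.2)| <= M z.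
  apply: le_trans (norm_dotp_le _ _ _) _.
  by rewrite ler_wpM2l// lerD2l sqnorm_contraction.
have iJ : mu.-integrable setT (fun z =>
    (dotp (sigma_grad sigma g z.1) (rho *m sigma_grad sigma g z.2))%:E).
  apply: le_integrable iM => //.
    by apply/measurable_EFinP; exact: (measurable_correlation rho).
  move=> z _ /=; rewrite lee_fin; apply: le_trans (le_M z) _.
  exact: ler_norm.
split=> //.
have eD : \int[mu]_z (N z.1 + N z.2) = \int[mu]_z N z.1 + \int[mu]_z N z.2.
  exact: (RintegralD measurableT i1 i2).
have eM : \int[mu]_z M z = 2^-1 * \int[mu]_z (N z.1 + N z.2).
  exact: (RintegralZl 2^-1 measurableT iD).
have -> : \int[nu]_x N x = \int[mu]_z M z.
  by rewrite eM eD e1 e2 mulrC mulrDl; exact: splitr.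
apply: le_Rintegral => // z _.
exact: le_trans (ler_norm _) (le_M z).
Qed.

End variance.

Theorem proposition10 (R : realType) (d q : nat)
    (b : 'cV[R]_d -> 'cV[R]_d) (sigma : 'cV[R]_d -> 'M[R]_(d, q))
    (nu : probability (borelV R d) R)
    (a : R) (V f g : 'cV[R]_d -> R)
    (rho : 'M[R]_q) (mu : probability (borelV R d * borelV R d)%type R)
    (b_lip : loc_lipschitz b) (b_growth : linear_growth b)
    (sigma_lip : loc_lipschitz sigma) (sigma_growth : linear_growth sigma)
    (nu_inv : unique_invariant_distribution (@diffusion R d q b sigma) nu)
    (a_gt0 : 0 < a) (a_le1 : a <= 1)
    (V_Sa : lyapunov_assumption b sigma a V)
    (g_C7 : class_C 7 g)
    (poisson : forall x, f x - \int[nu]_y f y = generator b sigma g x)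
    (dominated : exists C r : R, [/\ 0 < C, 0 <= r &
       forall x, [/\ `|f x| <= C * V x `^ r, `|g x| <= C * V x `^ r &
         forall s : seq 'I_d, (size s <= 7)%N ->
           `|partials s g x| <= C * V x `^ r]])
    (L2 : nu.-integrable setT (fun x => (sqnorm (sigma_grad sigma g x))%:E))
    (rho_adm : admissible_correlation rho)
    (mu_inv : unique_invariant_distribution
       (@duplicated_diffusion R d q b sigma rho) mu) :
  let I := \int[nu]_x sqnorm (sigma_grad sigma g x) in
  let var := asymptotic_variance sigma g rho nu mu in
  [/\ I <= var,
      rho = 0 -> var = 5 * I &
      rho = 1%:M -> var = I].
Proof.
have g_C1 : class_C 1 g by exact: class_C_le g_C7.
have marginals := marginals_invariant b sigma nu mu nu_inv rho mu_inv.1.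
have [int_corr corr_le] :=
  correlation_le sigma g sigma_lip g_C1 nu mu rho L2 marginals rho_adm.
move=> I var; rewrite /var /asymptotic_variance -/I; split.
- by move: corr_le; rewrite -/I; set J := Rintegral _ _ _; lra.
- move=> rho0; rewrite (_ : Rintegral mu _ _ = 0) ?mulr0 ?subr0//.
  rewrite -(mul0r (fine (mu setT))) -(@Rintegral_cst _ _ _ mu setT)//.
  by apply: eq_Rintegral => z _; rewrite rho0 mul0mx /dotp mulmx0 mxE.
- move=> rho1; rewrite rho1 in int_corr mu_inv *.
  have mu_diag := full_correlation_diagonal b sigma nu mu nu_inv mu_inv.
  have [_] := integrable_transport nu mu diag _ measurable_diag mu_diag int_corr.
  move=> <-; rewrite (_ : Rintegral _ _ _ = I); first by lra.
  by apply: eq_Rintegral => x _; rewrite mul1mx.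
Qed.
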